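(* Let $\mathcal{S}$ be a finite state space, $V:\mathcal{S}\to\mathbb{R}$ a function, $\pi$ the probability distribution on $\mathcal{S}$ with $\pi(s)\propto\exp(-V(s))$, and $T(g\mid f)$ a transition kernel on $\mathcal{S}$ satisfying $\pi(f)T(g\mid f)=\pi(g)T(f\mid g)$ for all $f,g\in\mathcal{S}$, whose state space graph is connected. Let $\mathbf{P}$ be the transition operator on $L^2(\pi)$, let $\mathcal{L}=I-\mathbf{P}$ be the normalized Laplacian with eigenvalues $0=\lambda_1<\lambda_2\le\lambda_3\le\dots\le\lambda_n$ (counted with multiplicity, $n=|\mathcal{S}|\ge 2$), let $\mu_i=1-\lambda_i$ be the eigenvalues of the self-adjoint operator $\mathbf{P}$, and let $\rho=\max_{i\ge 2}|\mu_i|$. For any initial distribution $P_0$ on $\mathcal{S}$, let $P_{t+1}(g)=\sum_{f\in\mathcal{S}}P_t(f)T(g\mid f)$, let $L(t)=\mathbb{E}_{s\sim P_t}[V(s)]$, and let $L_\infty=\mathbb{E}_{s\sim\pi}[V(s)]$. Then for every integer $t\ge 0$, $$|L(t)-L_\infty|\le\rho^{t}\cdot\sqrt{\mathrm{Var}_\pi(V)}\cdot\chi(P_0\,\|\,\pi),$$ where $\chi(P_0\,\|\,\pi)=\|P_0/\pi-1\|_{L^2(\pi)}$.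
   Context: A transition kernel $T$ satisfies $T(g\mid f)\ge 0$ and $\sum_{g\in\mathcal{S}}T(g\mid f)=1$ for every $f\in\mathcal{S}$. The state space graph has vertex set $\mathcal{S}$, with $f\ne g$ joined by an edge when $T(g\mid f)>0$ (equivalently $T(f\mid g)>0$ under detailed balance). $L^2(\pi)$ is the space of functions $\varphi:\mathcal{S}\to\mathbb{R}$ with inner product $\langle\varphi,\psi\rangle_\pi=\sum_s\pi(s)\varphi(s)\psi(s)$. The transition operator is $(\mathbf{P}\varphi)(f)=\sum_{g\in\mathcal{S}}T(g\mid f)\varphi(g)$, which is self-adjoint on $L^2(\pi)$ by detailed balance. *)

(* Defs.v *)
From HB Require Import structures.
From mathcomp Require Import all_boot all_order all_algebra.
From mathcomp Require Import reals sequences exp.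
Set Implicit Arguments.
Unset Strict Implicit.
Unset Printing Implicit Defensive.
Import Order.TTheory GRing.Theory Num.Theory.
Local Open Scope ring_scope.

Section Distributions.
Variables (R : realType) (S : finType).

Definition is_dist (p : S -> R) : Prop :=
  (forall s, 0 <= p s) /\ \sum_s p s = 1.

Definition gibbs (V : S -> R) (s : S) : R :=
  expR (- V s) / \sum_s' expR (- V s').

Definition expect (p V : S -> R) : R := \sum_s p s * V s.

Definition variance (p V : S -> R) : R :=
  expect p (fun s => (V s - expect p V) ^+ 2).

Definition inner (p phi psi : S -> R) : R := \sum_s p s * phi s * psi s.

Definition L2norm (p phi : S -> R) : R := Num.sqrt (inner p phi phi).

Definition chi (q p : S -> R) : R := L2norm p (fun s => q s / p s - 1).

End Distributions.

(* [T g f] is the probability T(g | f) of moving from f to g. *)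
Section Kernels.
Variables (R : realType) (S : finType) (T : S -> S -> R).

Definition is_kernel : Prop :=
  (forall g f, 0 <= T g f) /\ (forall f, \sum_g T g f = 1).

Definition detailed_balance (p : S -> R) : Prop :=
  forall f g, p f * T g f = p g * T f g.

Definition state_edge : rel S := fun f g => (f != g) && (0 < T g f).

(* [connect] follows edges in their direction; [state_edge] is symmetric as
   soon as T is in detailed balance with a positive distribution. *)
Definition state_connected : Prop := forall f g, connect state_edge f g.

Definition evolve (p : S -> R) (g : S) : R := \sum_f p f * T g f.

Definition dist_at (p0 : S -> R) (t : nat) : S -> R := iter t evolve p0.

Definition transition_fun (phi : {ffun S -> R^o}) : {ffun S -> R^o} :=
  [ffun f => \sum_g T g f * phi g].

Fact transition_fun_is_linear : linear transition_fun.
Proof.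
move=> a phi psi; apply/ffunP => f; rewrite !ffunE.
rewrite /GRing.scale /= mulr_sumr -big_split /=; apply: eq_bigr => g _.
by rewrite !ffunE /GRing.scale /= mulrDr mulrCA.
Qed.

HB.instance Definition _ :=
  GRing.isLinear.Build R {ffun S -> R^o} {ffun S -> R^o} _ transition_fun
    transition_fun_is_linear.

Definition transition_op : 'End({ffun S -> R^o}) := linfun transition_fun.

Definition laplacian : 'End({ffun S -> R^o}) := \1%VF - transition_op.

End Kernels.

(* [lam] lists the eigenvalues of [f], each repeated according to the dimension
   of its eigenspace; the length of [lam] says that these dimensions add up to
   that of the whole space (so [f] is diagonalizable over R). *)
Definition spectrum (R : realType) (S : finType)
    (f : 'End({ffun S -> R^o})) (lam : #|S|.-tuple R) : Prop :=
  forall a : R, count_mem a lam = \dim (passmx.leigenspace f a).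

(* Positions start at 0: lambda_1 and mu_1 are the entries at index 0. *)
Definition mu (R : realType) (n : nat) (lam : n.-tuple R) : n.-tuple R :=
  [tuple 1 - tnth lam i | i < n].

(* The default value 0 of the maximum is used only when n <= 1. *)
Definition rho (R : realType) (n : nat) (lam : n.-tuple R) : R :=
  \big[Num.max/0]_(i < n | (0 < i)%N) `|tnth (mu lam) i|.

(* Main.v *)
(* Scaling by [sqrt p] makes an operator that is selfadjoint in L^2(p) a real
   symmetric matrix; over R[i] such a matrix is unitarily diagonalizable with
   real eigenvalues, so its minimal polynomial splits into distinct factors
   over R, and the eigenspaces span.  They are mutually orthogonal, so their
   dimensions add up to that of the whole space.  The Dirichlet form of a
   reversible connected chain is nonnegative and vanishes only on constants, so
   0 is a simple eigenvalue of the Laplacian and the smallest one.  Detailed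
   balance says that P_t/pi is the image of P_0/pi under the t-th power of P,
   and L(t) - L_oo is the inner product of P_t/pi - 1, which is orthogonal to
   constants, with V - E_pi[V]: expand in eigenspaces and apply
   Cauchy-Schwarz. *)
Require Import Defs.
From mathcomp Require Import all_boot all_order all_algebra.
From mathcomp Require Import spectral complex.
From mathcomp Require Import ring.
From mathcomp Require Import reals sequences exp.
Set Implicit Arguments.
Unset Strict Implicit.
Import Order.TTheory GRing.Theory Num.Theory.
Local Open Scope ring_scope.

(** * Spectral theorem for real symmetric matrices *)

Lemma symmetric_eigenspaces (R : rcfType) (n : nat) (A : 'M[R]_n) :
  A^T = A ->
  exists2 rs : seq R, uniq rs & (\sum_(r <- rs) eigenspace A r :=: 1%:M)%MS.
Proof.
case: n A => [|n] A symA.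
  by exists [::]; rewrite // big_nil [1%:M]flatmx0.
apply/diagonalizablePeigen/diagonalizableP.
pose f := @real_complex_def R (Phant R).
pose AC : 'M[R[i]]_n.+1 := map_mx f A.
have symAC : AC \is symmetricmx.
  by apply/is_hermitianmxP;
    rewrite expr0 scale1r map_mx_id // /AC map_trmx symA.
have realAC : AC \is a mxOver Num.real.
  by apply/mxOverP => i j; rewrite mxE; apply/complex_realP; exists (A i j).
have hermAC := realsym_hermsym symAC realAC.
set P := spectralmx AC; set d := spectral_diag AC.
have Pu : P \in unitmx := spectral_unit AC.
(* The eigenvalues over [R[i]] are real, so [d] is the image of a real row; this is what lets the
   equality of minimal polynomials descend along the injective map [f]. *)
have dE : map_mx f (map_mx (@complex.Re R) d) = d.
  apply/matrixP => i j; rewrite !mxE.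
  have /mxOverP/(_ i j)/complex_realP[x /= ->] :=
    hermitian_spectral_diag_real hermAC.
  by [].
have /orthomx_spectralP : AC \is normalmx := symmetric_normalmx symAC realAC.
rewrite -/P -/d -conjVmx // => ACE.
have minAC : mxminpoly AC = mxminpoly (diag_mx d).
  clearbody P d; rewrite ACE; apply: mxminpoly_uconj.
  by rewrite unitmx_inv.
have : map_poly f (mxminpoly A) =
       map_poly f (mxminpoly (diag_mx (map_mx (@complex.Re R) d))).
  by rewrite -[LHS]mxminpoly_map -[RHS]mxminpoly_map map_diag_mx dE.
move=> /map_poly_inj ->.
(* The minimal polynomial of a diagonal matrix is the product of ['X - r] over its distinct entries
   [r]; the list of these is the witness. *)
rewrite mxminpoly_diag.
eexists; last exact: dvdpp.
exact: undup_uniq.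
Qed.

Lemma mem_leigenspace (F : fieldType) (E : vectType F) (f : 'End(E)) (a : F)
    (v : E) :
  (v \in passmx.leigenspace f a) = (f v == a *: v).
Proof.
by rewrite memv_ker !(add_lfunE, opp_lfunE, scale_lfunE) id_lfunE subr_eq0.
Qed.

(** * Selfadjoint operators on a weighted $L^2$ space *)

Section WeightedL2.
Variables (R : realType) (S : finType) (p : S -> R).
Local Notation E := {ffun S -> R^o}.
Local Notation leigenspace := passmx.leigenspace.

Definition selfadjoint (f : 'End(E)) : Prop :=
  forall phi psi : E, inner p (f phi) psi = inner p phi (f psi).

Lemma innerC (phi psi : S -> R) : inner p phi psi = inner p psi phi.
Proof. by apply: eq_bigr => s _; rewrite mulrAC. Qed.

Lemma innerZl (a : R) (phi psi : E) :
  inner p (a *: phi) psi = a * inner p phi psi.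
Proof.
rewrite /inner mulr_sumr; apply: eq_bigr => s _.
by rewrite !ffunE mulrCA !mulrA.
Qed.

Lemma innerZr (a : R) (phi psi : E) :
  inner p phi (a *: psi) = a * inner p phi psi.
Proof. by rewrite innerC innerZl innerC. Qed.

Lemma inner_suml (I : Type) (r : seq I) (P : pred I) (F : I -> E) (psi : E) :
  inner p (\sum_(i <- r | P i) F i) psi = \sum_(i <- r | P i) inner p (F i) psi.
Proof.
rewrite /inner exchange_big /=; apply: eq_bigr => s _.
by rewrite sum_ffunE mulr_sumr mulr_suml.
Qed.

Lemma inner_sumr (I : Type) (r : seq I) (P : pred I) (F : I -> E) (psi : E) :
  inner p psi (\sum_(i <- r | P i) F i) = \sum_(i <- r | P i) inner p psi (F i).
Proof. by rewrite innerC inner_suml; apply: eq_bigr => i _; rewrite innerC. Qed.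

Lemma selfadjoint_orthogonal (f : 'End(E)) (a b : R) (phi psi : E) :
  selfadjoint f -> a != b -> phi \in leigenspace f a ->
  psi \in leigenspace f b -> inner p phi psi = 0.
Proof.
move=> f_sa neq_ab; rewrite !mem_leigenspace => /eqP fphi /eqP fpsi.
have /eqP := f_sa phi psi; rewrite fphi fpsi innerZl innerZr.
by rewrite -subr_eq0 -mulrBl mulf_eq0 subr_eq0 (negPf neq_ab) => /eqP.
Qed.

Hypothesis p_gt0 : forall s, 0 < p s.

Lemma inner_ge0 (phi : S -> R) : 0 <= inner p phi phi.
Proof.
by apply: sumr_ge0 => s _; rewrite -mulrA mulr_ge0 ?(ltW (p_gt0 s)) ?sqr_ge0.
Qed.

Lemma inner_eq0 (phi : E) : inner p phi phi = 0 -> phi = 0.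
Proof.
move=> /eqP; rewrite psumr_eq0; last first.
  by move=> s _; rewrite -mulrA mulr_ge0 ?(ltW (p_gt0 s)) ?sqr_ge0.
move=> /allP phi0; apply/ffunP => s; have := phi0 s (mem_index_enum s).
by rewrite !mulf_eq0 gt_eqF //= orbb => /eqP ->; rewrite ffunE.
Qed.

(** Cauchy-Schwarz by Lagrange's identity: twice the difference of the two sides is a weighted
    double sum of squares. *)
Lemma sqr_inner_le (phi psi : S -> R) :
  inner p phi psi ^+ 2 <= inner p phi phi * inner p psi psi.
Proof.
have : 0 <= \sum_s \sum_t p s * p t * (phi s * psi t - phi t * psi s) ^+ 2.
  by do 2!apply: sumr_ge0 => ? _; rewrite mulr_ge0 ?sqr_ge0 // mulr_ge0 ?ltW.
suff -> : \sum_s \sum_t p s * p t * (phi s * psi t - phi t * psi s) ^+ 2 =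
    (inner p phi phi * inner p psi psi - inner p phi psi ^+ 2) *+ 2.
  by rewrite pmulrn_lge0 // subr_ge0.
have mulE (a b c d : S -> R) : inner p a b * inner p c d =
    \sum_s \sum_t p s * p t * (a s * b s * c t * d t).
  rewrite /inner mulr_suml; apply: eq_bigr => s _; rewrite mulr_sumr.
  by apply: eq_bigr => t _; ring.
rewrite mulr2n expr2 {2}[inner p phi phi * _]mulrC !mulE -!sumrB -big_split /=.
apply: eq_bigr => s _; rewrite -!sumrB -big_split /=.
by apply: eq_bigr => t _; ring.
Qed.

(* Multiplication by [sqrt p] turns a selfadjoint operator of L^2(p) into a
   symmetric matrix. *)
Lemma selfadjoint_eigenspaces (f : 'End(E)) : selfadjoint f ->
  exists2 rs : seq R, uniq rs &
    (\sum_(i < size rs) leigenspace f rs`_i)%VS = fullv.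
Proof.
move=> f_sa.
have q_neq0 s : Num.sqrt (p s) != 0 by rewrite sqrtr_eq0 -ltNge.
pose delta (i : 'I_#|S|) : E := [ffun s => (s == enum_val i)%:R].
pose q (i : 'I_#|S|) := Num.sqrt (p (enum_val i)).
have qq i : q i * q i = p (enum_val i) by rewrite -expr2 sqr_sqrtr ?ltW.
(* With row vectors, this is the matrix of [f] in the basis [delta i / q i], which is orthonormal
   for [inner p]; [vec] below maps coordinates back to functions. *)
pose A : 'M[R]_#|S| := \matrix_(i, j) (q j * f (delta i) (enum_val j) / q i).
have inner_delta (phi : E) i :
      inner p phi (delta i) = p (enum_val i) * phi (enum_val i).
  rewrite /inner (bigD1 (enum_val i)) //= ffunE eqxx mulr1 big1 ?addr0 // => s.
  by move=> /negPf si; rewrite ffunE si mulr0.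
have symA : A^T = A.
  apply/matrixP => i j; rewrite !mxE.
  have := f_sa (delta i) (delta j); rewrite innerC -[LHS]innerC inner_delta.
  rewrite [RHS]innerC inner_delta -!qq => eq_ij.
  apply: (mulfI (q_neq0 (enum_val i))); apply: (mulfI (q_neq0 (enum_val j))).
  rewrite -/(q i) -/(q j).
  transitivity (q i * q i * f (delta j) (enum_val i)).
    by field; apply: q_neq0.
  by rewrite -eq_ij; field; apply: q_neq0.
have [rs urs rsP] := symmetric_eigenspaces symA; exists rs => //.
pose vec (u : 'rV[R]_#|S|) : E :=
  [ffun s => u 0 (enum_rank s) / Num.sqrt (p s)].
have vecZ a u : vec (a *: u) = a *: vec u.
  by apply/ffunP => s; rewrite !ffunE mxE -mulrA.
have vecE u : vec u = \sum_i (u 0 i / q i) *: delta i.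
  apply/ffunP => s; rewrite sum_ffunE ffunE (bigD1 (enum_rank s)) //=.
  rewrite !ffunE /q enum_rankK eqxx [_ *: _]mulr1 big1 ?addr0 // => i.
  rewrite !ffunE => neq_i; case: eqP => [sE|_]; last exact: mulr0.
  by rewrite sE enum_valK eqxx in neq_i.
have vecA u : vec (u *m A) = f (vec u).
  rewrite [vec u]vecE linear_sum; apply/ffunP => s.
  rewrite sum_ffunE ffunE mxE mulr_suml; apply: eq_bigr => i _.
  rewrite linearZ ffunE mxE /q enum_rankK /=.
  by rewrite [RHS]/GRing.scale /=; field; rewrite !q_neq0.
apply/eqP; rewrite eqEsubv subvf; apply/subvP => phi _.
pose u : 'rV[R]_#|S| := \row_i (q i * phi (enum_val i)).
have -> : phi = vec u.
  by apply/ffunP => s; rewrite ffunE mxE /q enum_rankK mulrAC divff ?mul1r.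
have : (u <= 1%:M)%MS by apply: submx1.
rewrite -rsP (big_nth 0) big_mkord => /sub_sumsmxP[w ->].
have -> : vec (\sum_(i < size rs) w i *m eigenspace A rs`_i) =
    \sum_(i < size rs) vec (w i *m eigenspace A rs`_i).
  apply/ffunP => s; rewrite sum_ffunE ffunE summxE mulr_suml.
  by apply: eq_bigr => i _; rewrite ffunE.
apply: memv_sumr => i _; rewrite mem_leigenspace -vecA -vecZ; apply/eqP.
by congr vec; apply/eigenspaceP; rewrite submxMl.
Qed.

(** Orthogonality makes the spanning sum of eigenspaces direct, so their dimensions add up to
    [#|S|]. Repeating each [r] in [rs] as often as its dimension and sorting gives the list. *)
Lemma selfadjoint_spectrum (f : 'End(E)) : selfadjoint f ->
  exists2 lam : #|S|.-tuple R, spectrum f lam & sorted <=%R lam.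
Proof.
move=> f_sa; have [rs urs rsP] := selfadjoint_eigenspaces f_sa.
have rs_inj (i j : 'I_(size rs)) : i != j -> rs`_i != rs`_j.
  by apply: contra => /eqP /uniqP ij; apply/eqP/val_inj/ij => //; rewrite inE.
have dirE : directv (\sum_(i < size rs) leigenspace f rs`_i)%VS.
  apply/directv_sum_independent => us us_in us0 i _.
  apply: inner_eq0.
  transitivity (inner p (us i) (\sum_j us j)).
    rewrite inner_sumr (bigD1 i) //= [X in _ + X]big1 ?addr0 // => j ji.
    apply: selfadjoint_orthogonal f_sa _ (us_in i _) (us_in j _) => //.
    by rewrite rs_inj // eq_sym.
  by rewrite us0 /inner big1 // => s _; rewrite ffunE mulr0.
have dim_sum : (\sum_(r <- rs) \dim (leigenspace f r))%N = #|S|.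
  rewrite (big_nth 0) big_mkord -(directvP dirE) /= rsP dimvf /=.
  by rewrite /dim /= muln1.
pose lam := flatten [seq nseq (\dim (leigenspace f r)) r | r <- rs].
have lam_count a : count_mem a lam = \dim (leigenspace f a).
  rewrite count_flatten -map_comp sumnE big_map.
  under eq_bigr => r _ do rewrite /= count_nseq /=.
  have [a_rs|a_rs] := boolP (a \in rs).
    rewrite (bigD1_seq a) //= eqxx mul1n big1 ?addn0 // => r /negPf ->.
    by rewrite mul0n.
  rewrite big1_seq; last first.
    move=> r /= r_rs; case: eqP => [ra|_]; last by rewrite mul0n.
    by rewrite -ra r_rs in a_rs.
  (* An eigenvector for a value outside [rs] is orthogonal to eigenspaces that span the whole space,
     hence to itself. *)
  apply/esym/eqP; rewrite dimv_eq0 -subv0; apply/subvP => phi phi_a.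
  rewrite memv0; apply/eqP/inner_eq0.
  have : phi \in fullv by apply: memvf.
  rewrite -rsP => /memv_sumP[us us_in phiE].
  rewrite {2}phiE inner_sumr big1 // => i _.
  apply: selfadjoint_orthogonal f_sa _ phi_a (us_in i _) => //.
  by apply: contraNneq a_rs => ->; apply: mem_nth.
have size_lam : size (sort <=%R lam) == #|S|.
  rewrite size_sort size_flatten /shape -map_comp sumnE big_map.
  by apply/eqP; rewrite -dim_sum; apply: eq_bigr => r _; rewrite /= size_nseq.
exists (Tuple size_lam) => [a /=|].
  rewrite -lam_count; apply/permP; exact: permEl (perm_sort _ _).
exact: (sort_sorted (@le_total _ R)).
Qed.

End WeightedL2.

(** Turns simplicity of the least eigenvalue into a spectral gap. A head above [x] would force count
    0, and a second entry equal to [x] would force count at least 2. *)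
Lemma sorted_simple_min (R : realDomainType) (x : R) (s : seq R) :
  sorted <=%R s -> {in s, forall y, x <= y} -> count_mem x s = 1%N ->
  (1 < size s)%N -> s`_0 = x /\ x < s`_1.
Proof.
case: s => [|y [|z s]] //= /andP[yz sz] ge_x cnt_x _.
have yx : y = x.
  apply: contra_eq cnt_x => yx; have xy : x < y.
    by rewrite lt_neqAle eq_sym yx ge_x ?mem_head.
  rewrite (negPf yx) add0n.
  have /allP le_z := order_path_min (@le_trans _ R) sz.
  have /count_memPn -> : x \notin s.
    apply/negP => x_s.
    by have := lt_le_trans xy (le_trans yz (le_z x x_s)); rewrite ltxx.
  by rewrite (gt_eqF (lt_le_trans xy yz)).
split=> //; rewrite lt_neqAle -{2}yx yz andbT; apply: contra_eq_neq cnt_x.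
by move=> <-; rewrite yx eqxx.
Qed.

(** * Reversible chains: the Laplacian and its kernel *)

Section ReversibleChains.
Variables (R : realType) (S : finType) (p : S -> R) (T : S -> S -> R).
Hypothesis p_gt0 : forall s, 0 < p s.
Hypothesis kernel_T : is_kernel T.
Hypothesis balance_T : detailed_balance T p.
Local Notation E := {ffun S -> R^o}.
Local Notation leigenspace := passmx.leigenspace.

Lemma transition_opE (phi : E) (f : S) :
  transition_op T phi f = \sum_g T g f * phi g.
Proof. by rewrite lfunE /= ffunE. Qed.

Lemma laplacianE (phi : E) : laplacian T phi = phi - transition_op T phi.
Proof. by rewrite add_lfunE opp_lfunE id_lfunE. Qed.

Lemma laplacian_selfadjoint : selfadjoint p (laplacian T).
Proof.
move=> phi psi; rewrite !laplacianE /inner.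
under eq_bigr => s _ do rewrite !ffunE transition_opE mulrBr mulrBl.
under [RHS]eq_bigr => s _ do rewrite !ffunE transition_opE mulrBr.
rewrite !sumrB; congr (_ - _).
under eq_bigr => s _ do rewrite mulr_sumr mulr_suml.
under [RHS]eq_bigr => s _ do rewrite mulr_sumr.
rewrite exchange_big; apply: eq_bigr => s _; apply: eq_bigr => t _ /=.
by rewrite [p t * _]mulrA balance_T; ring.
Qed.

(** Expanding the square leaves two diagonal sums, both equal to [inner p phi phi]: one because [T]
    is a kernel, the other by detailed balance after exchanging the sums. *)
Lemma dirichlet_form (phi : E) :
  inner p phi (laplacian T phi) *+ 2 =
  \sum_f \sum_g p f * T g f * (phi f - phi g) ^+ 2.
Proof.
have sqr_l : \sum_f \sum_g p f * T g f * phi f ^+ 2 = inner p phi phi.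
  apply: eq_bigr => f _; rewrite -mulr_suml -mulr_sumr kernel_T.2.
  by rewrite mulr1 expr2 mulrA.
have sqr_r : \sum_f \sum_g p f * T g f * phi g ^+ 2 = inner p phi phi.
  rewrite -sqr_l exchange_big; apply: eq_bigr => f _; apply: eq_bigr => g _ /=.
  by rewrite balance_T.
rewrite laplacianE /inner.
under eq_bigr => s _ do rewrite !ffunE transition_opE mulrBr.
rewrite sumrB -/(inner p phi phi) mulr2n -{1}sqr_l -sqr_r -!sumrB -big_split /=.
apply: eq_bigr => f _; rewrite !mulr_sumr -!sumrB -big_split /=.
by apply: eq_bigr => g _; ring.
Qed.

Lemma dirichlet_term_ge0 (f g : S) (x : R) : 0 <= p f * T g f * x ^+ 2.
Proof. by rewrite mulr_ge0 ?sqr_ge0 // mulr_ge0 ?kernel_T.1 // ltW. Qed.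

Lemma laplacian_ge0 (phi : E) : 0 <= inner p phi (laplacian T phi).
Proof.
rewrite -(pmulrn_lge0 _ (isT : (0 < 2)%N)) dirichlet_form.
by do 2!apply: sumr_ge0 => ? _; apply: dirichlet_term_ge0.
Qed.

(** For an eigenvector, [a] times its positive squared norm is the nonnegative value
    [inner p phi (laplacian T phi)]. *)
Lemma laplacian_eigenvalue_ge0 (a : R) :
  leigenspace (laplacian T) a != 0%VS -> 0 <= a.
Proof.
move=> a_neq0; have := memv_pick (leigenspace (laplacian T) a).
rewrite mem_leigenspace; set phi := vpick _ => /eqP phi_a.
have := laplacian_ge0 phi; rewrite phi_a innerZr pmulr_lge0 //.
rewrite lt_neqAle inner_ge0 // andbT eq_sym.
apply/eqP => /(inner_eq0 p_gt0)/eqP.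
by rewrite vpick0 (negPf a_neq0).
Qed.

Lemma laplacian_cst (a : R^o) : laplacian T [ffun=> a] = 0.
Proof.
apply/ffunP => f; rewrite laplacianE !ffunE transition_opE.
under eq_bigr => g _ do rewrite ffunE.
by rewrite -mulr_suml kernel_T.2 mul1r subrr.
Qed.

(** A vanishing Dirichlet form has only vanishing terms, so [phi] agrees at the two ends of each
    edge; induction along a path does the rest. *)
Lemma laplacian_ker (phi : E) : state_connected T -> laplacian T phi = 0 ->
  forall f g, phi f = phi g.
Proof.
move=> conT phi0.
have ge0 f g : 0 <= p f * T g f * (phi f - phi g) ^+ 2.
  exact: dirichlet_term_ge0.
have edgeE f g : state_edge T f g -> phi f = phi g.
  move=> /andP[_ Tgf]; have /eqP := dirichlet_form phi.
  rewrite phi0 /inner big1 => [|s _]; last by rewrite ffunE mulr0.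
  rewrite mul0rn eq_sym psumr_eq0 => [|s _]; last exact: sumr_ge0.
  move=> /allP/(_ f (mem_index_enum f)) /=; rewrite psumr_eq0 //.
  move=> /allP/(_ g (mem_index_enum g)) /=.
  by rewrite !mulf_eq0 (gt_eqF (p_gt0 f)) (gt_eqF Tgf) /= orbb subr_eq0 => /eqP.
move=> f g; have /connectP[w] := conT f g.
elim: w f => [|h w IHw] f /= => [_ ->//|/andP[fh hw] gE].
by rewrite (edgeE _ _ fh) (IHw h).
Qed.

Lemma dim_laplacian_ker (s0 : S) : state_connected T ->
  \dim (leigenspace (laplacian T) 0) = 1%N.
Proof.
move=> conT; pose one : E := [ffun=> 1].
have -> : leigenspace (laplacian T) 0 = <[one]>%VS.
  apply/vspaceP => phi; rewrite mem_leigenspace scale0r.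
  apply/eqP/vlineP => [phi0|[a ->]]; last first.
    by rewrite linearZ /= /one laplacian_cst scaler0.
  exists (phi s0); apply/ffunP => s; rewrite !ffunE [_ *: _]mulr1.
  exact: laplacian_ker.
(* The state [s0] witnesses that the constant function 1 is nonzero. *)
rewrite dim_vline; case: eqP => // /ffunP/(_ s0)/eqP.
by rewrite !ffunE oner_eq0.
Qed.

(** * Spectrum of the transition operator and decay to equilibrium *)

Lemma transition_leigenspace (a : R) :
  leigenspace (transition_op T) a = leigenspace (laplacian T) (1 - a).
Proof.
apply/vspaceP => phi; rewrite [LHS]mem_leigenspace [RHS]mem_leigenspace.
rewrite laplacianE scalerBl scale1r.
apply/eqP/eqP => [->//|/addrI /oppr_inj //].
Qed.

Lemma transition_spectrum (lam : #|S|.-tuple R) :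
  spectrum (laplacian T) lam -> spectrum (transition_op T) (mu lam).
Proof.
move=> lamP a; rewrite transition_leigenspace -lamP.
rewrite -[in RHS](map_tnth_enum lam) /= !count_map; apply: eq_count => i /=.
by rewrite subr_eq addrC -subr_eq eq_sym.
Qed.

Lemma rho_ge0 (n : nat) (lam : n.-tuple R) : 0 <= rho lam.
Proof. exact: bigmax_ge_id. Qed.

(** A nonzero eigenvalue cannot sit at index 0, where [lam] is 0, so its [1 - a] takes part in the
    maximum. *)
Lemma rho_ge (lam : #|S|.-tuple R) (a : R) : spectrum (laplacian T) lam ->
  lam`_0 = 0 -> a != 0 -> leigenspace (laplacian T) a != 0%VS ->
  `|1 - a| <= rho lam.
Proof.
move=> lamP lam0 a_neq0 Ea.
have /tnthP[i aE] : a \in lam.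
  by rewrite -has_pred1 has_count lamP lt0n dimv_eq0.
have i_gt0 : (0 < i)%N.
  rewrite lt0n; apply: contraNneq a_neq0 => i0.
  by rewrite aE (tnth_nth 0) i0 lam0.
have -> : 1 - a = tnth (mu lam) i by rewrite tnth_mktuple -aE.
exact: (@le_bigmax_cond _ _ _ 0 i (fun j => (0 < j)%N)
          (fun j => `|tnth (mu lam) j|)).
Qed.

Lemma iter_transition_eigen (t : nat) (a : R) (phi : E) :
  phi \in leigenspace (laplacian T) a ->
  iter t (transition_op T) phi = (1 - a) ^+ t *: phi.
Proof.
move=> phi_a; have {phi_a} : phi \in leigenspace (transition_op T) (1 - a).
  by rewrite transition_leigenspace subKr.
rewrite mem_leigenspace => /eqP phi_a.
elim: t => [|t IHt]; first by rewrite scale1r.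
by rewrite iterS IHt linearZ /= phi_a scalerA -exprSr.
Qed.

(* The component of [h] in the kernel of the Laplacian is a constant function,
   hence vanishes as soon as [h] has mean zero; every other eigencomponent is
   contracted by a factor at most [rho lam]. *)
Lemma transition_decay (lam : #|S|.-tuple R) (h : E) (t : nat) :
  state_connected T -> spectrum (laplacian T) lam -> lam`_0 = 0 ->
  \sum_s p s * h s = 0 ->
  L2norm p (iter t (transition_op T) h) <= rho lam ^+ t * L2norm p h.
Proof.
move=> conT lamP lam0 h_mean0.
have [rs urs rsP] := selfadjoint_eigenspaces p_gt0 laplacian_selfadjoint.
have : h \in fullv by apply: memvf.
rewrite -rsP => /memv_sumP[u u_in hE].
have u_inE i : u i \in leigenspace (laplacian T) rs`_i by apply: u_in.
have u_orth i j : j != i -> inner p (u i) (u j) = 0.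
  move=> ji.
  apply: selfadjoint_orthogonal laplacian_selfadjoint _ (u_inE i) (u_inE j).
  rewrite nth_uniq //; apply: contra ji => /eqP ij; exact/eqP/val_inj/esym.
have iterE : iter t (transition_op T) h =
      \sum_(i < size rs) (1 - rs`_i) ^+ t *: u i.
  rewrite hE; under [RHS]eq_bigr => i _ do
    rewrite -(iter_transition_eigen t (u_inE i)).
  by elim: t => //= t ->; rewrite linear_sum.
have norm_sum (c : 'I_(size rs) -> R) :
    inner p (\sum_i c i *: u i) (\sum_i c i *: u i) =
    \sum_i c i ^+ 2 * inner p (u i) (u i).
  rewrite inner_suml; apply: eq_bigr => i _; rewrite inner_sumr (bigD1 i) //=.
  rewrite big1 ?addr0 => [|j ji]; first by rewrite innerZl innerZr mulrA.
  by rewrite innerZl innerZr u_orth ?mulr0.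
have norm_h : inner p h h = \sum_i inner p (u i) (u i).
  have -> : h = \sum_i 1 *: u i.
    by rewrite hE; apply: eq_bigr => i _; rewrite scale1r.
  by rewrite norm_sum; apply: eq_bigr => i _; rewrite expr1n mul1r.
rewrite /L2norm -[rho lam ^+ t]ger0_norm ?exprn_ge0 ?rho_ge0 //.
rewrite -sqrtr_sqr -sqrtrM ?sqr_ge0 //; apply: ler_wsqrtr.
rewrite iterE norm_sum norm_h mulr_sumr; apply: ler_sum => i _.
have [ui0|ui_neq0] := eqVneq (u i) 0.
  by rewrite ui0 /inner big1 ?mulr0 // => s _; rewrite ffunE mulr0.
apply: ler_wpM2r; first exact: inner_ge0.
rewrite -[leLHS]real_normK ?num_real // lerXn2r ?nnegrE ?exprn_ge0 ?rho_ge0 //.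
rewrite normrX lerXn2r ?nnegrE ?rho_ge0 //.
apply: rho_ge => //.
  apply: contra_neq ui_neq0 => ri0; apply: (inner_eq0 p_gt0).
  (* By orthogonality, pairing [u i] with [h] retains only its squared norm; a constant [u i] pairs
     to 0 with the mean-zero [h]. *)
  transitivity (inner p (u i) h).
    rewrite {1}hE inner_sumr (bigD1 i) //= [X in _ = _ + X]big1 ?addr0 // => j.
    exact: u_orth.
  have u_cst : forall f g, u i f = u i g.
    apply: laplacian_ker => //; apply/eqP; have := u_inE i.
    by rewrite mem_leigenspace ri0 scale0r.
  case: (pickP S) => [s0 _|S0]; last by rewrite /inner big_pred0.
  rewrite -[RHS](mulr0 (u i s0)) -h_mean0 mulr_sumr.
  by apply: eq_bigr => s _; rewrite (u_cst s s0); ring.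
by apply: contraNneq ui_neq0 => Ei0; have := u_inE i; rewrite Ei0 memv0.
Qed.

(* Detailed balance turns the evolution of distributions into the action of the
   transition operator on their densities. *)
Lemma dist_at_density (P0 : S -> R) (t : nat) :
  iter t (transition_op T) [ffun s => P0 s / p s - 1] =
  [ffun s => dist_at T P0 t s / p s - 1] :> E.
Proof.
elim: t => [//|t IHt]; rewrite iterS IHt; apply/ffunP => s.
rewrite transition_opE ffunE /dist_at iterS -/(dist_at T P0 t) /evolve.
under eq_bigr => g _ do rewrite ffunE mulrBr mulr1.
rewrite sumrB kernel_T.2 mulr_suml; congr (_ - 1); apply: eq_bigr => g _.
apply: (mulfI (lt0r_neq0 (p_gt0 s))); rewrite mulrA balance_T.
by field; rewrite !lt0r_neq0.
Qed.

Lemma evolve_mass (P : S -> R) : \sum_s evolve T P s = \sum_s P s.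
Proof.
rewrite exchange_big; apply: eq_bigr => s _ /=.
by rewrite -mulr_sumr kernel_T.2 mulr1.
Qed.

Lemma dist_at_mass (P0 : S -> R) (t : nat) :
  \sum_s dist_at T P0 t s = \sum_s P0 s.
Proof. by elim: t => [//|t IHt]; rewrite -IHt; apply: evolve_mass. Qed.

(** Both distributions have mass 1, so [V] may be replaced by the centred [W], whose norm is the
    standard deviation. Cauchy-Schwarz then reduces the bound to [transition_decay] for the density
    [h]. *)
Lemma expect_decay (lam : #|S|.-tuple R) (V P0 : S -> R) (t : nat) :
  state_connected T -> spectrum (laplacian T) lam -> lam`_0 = 0 ->
  \sum_s p s = 1 -> \sum_s P0 s = 1 ->
  `|expect (dist_at T P0 t) V - expect p V| <=
    rho lam ^+ t * Num.sqrt (variance p V) * chi P0 p.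
Proof.
move=> conT lamP lam0 p1 P01.
pose h : E := [ffun s => P0 s / p s - 1].
pose W s := V s - expect p V.
have divK (P : S -> R) s : p s * (P s / p s - 1) = P s - p s.
  by rewrite mulrBr mulr1 mulrCA divff ?mulr1 ?lt0r_neq0.
have h_mean0 : \sum_s p s * h s = 0.
  by under eq_bigr => s _ do rewrite ffunE divK; rewrite sumrB P01 p1 subrr.
have chiE : chi P0 p = L2norm p h.
  by congr Num.sqrt; apply: eq_bigr => s _; rewrite ffunE.
have varE : variance p V = inner p W W.
  by apply: eq_bigr => s _; rewrite expr2 mulrA.
have -> : expect (dist_at T P0 t) V - expect p V =
    inner p (iter t (transition_op T) h) W.
  rewrite dist_at_density /inner.
  under [RHS]eq_bigr => s _ do rewrite ffunE divK mulrBr.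
  rewrite sumrB -mulr_suml sumrB dist_at_mass P01 p1 subrr mul0r subr0.
  by rewrite /expect -sumrB; apply: eq_bigr => s _; rewrite mulrBl.
have := sqr_inner_le p_gt0 (iter t (transition_op T) h) W.
move=> /ler_wsqrtr; rewrite sqrtr_sqr sqrtrM ?inner_ge0 // => /le_trans; apply.
rewrite mulrAC chiE varE; apply: ler_wpM2r; first exact: sqrtr_ge0.
exact: transition_decay.
Qed.

End ReversibleChains.

(** * The Gibbs distribution and assembly of the theorem *)

Lemma gibbs_gt0 (R : realType) (S : finType) (V : S -> R) (s : S) :
  0 < gibbs V s.
Proof.
rewrite divr_gt0 ?expR_gt0 // (bigD1 s) //= ltr_pwDl ?expR_gt0 //.
by apply: sumr_ge0 => ? _; apply: expR_ge0.
Qed.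

Lemma gibbs_mass (R : realType) (S : finType) (V : S -> R) (s0 : S) :
  \sum_s gibbs V s = 1.
Proof.
have := gibbs_gt0 V s0; rewrite /gibbs -mulr_suml => V_gt0.
(* Were the partition function 0, its inverse would be 0 by convention, contradicting positivity at
   [s0]. *)
by rewrite divff //; apply: contraTneq V_gt0 => ->; rewrite invr0 mulr0 ltxx.
Qed.

Theorem theorem4p8 (R : realType) (S : finType) (V : S -> R) (T : S -> S -> R)
    (card_S : (2 <= #|S|)%N)
    (kernel_T : is_kernel T)
    (balance_T : detailed_balance T (gibbs V))
    (connected_T : state_connected T) :
  exists lam : #|S|.-tuple R,
    [/\ spectrum (laplacian T) lam,
        sorted <=%R lam,
        lam`_0 = 0 /\ 0 < lam`_1,
        spectrum (transition_op T) (mu lam)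
      & forall P0 : S -> R, is_dist P0 -> forall t : nat,
          `|expect (dist_at T P0 t) V - expect (gibbs V) V|
            <= rho lam ^+ t * Num.sqrt (variance (gibbs V) V)
               * chi P0 (gibbs V)].
Proof.
have /card_gt0P[s0 _] : (0 < #|S|)%N by apply: leq_trans card_S.
have p_gt0 := gibbs_gt0 V.
have [lam lamP lam_sorted] :=
  selfadjoint_spectrum p_gt0 (laplacian_selfadjoint balance_T).
have lam_ge0 : {in lam, forall x, 0 <= x}.
  move=> x; rewrite -has_pred1 has_count lamP lt0n dimv_eq0.
  exact: laplacian_eigenvalue_ge0 p_gt0 kernel_T balance_T x.
have lam_simple : count_mem 0 lam = 1%N.
  by rewrite lamP (dim_laplacian_ker p_gt0).
have size_lam : (1 < size lam)%N by rewrite size_tuple.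
have [lam0 lam1] := sorted_simple_min lam_sorted lam_ge0 lam_simple size_lam.
exists lam; split=> //; first exact: transition_spectrum.
move=> P0 [_ P01] t; apply: expect_decay => //.
exact: gibbs_mass.
Qed.
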